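(* Let $G$ be a connected graph of order $n$ with chromatic number $\chi$. Then $$m_{D^{L}(G)}[n,n+2)\leq \chi-1.$$ The inequality is sharp: equality holds for all (connected) complete multipartite graphs.
   Context: All graphs are finite, simple and connected. For a connected graph $G$ with vertex set $\{v_1,\dots,v_n\}$, $d_{uv}$ is the length of a shortest path between $u$ and $v$, $D(G)=(d_{uv})$ is the distance matrix, $Tr(v)=\sum_{u\in V(G)}d_{uv}$ is the transmission of $v$, and the distance Laplacian matrix is $D^L(G)=\mathrm{diag}(Tr(v_1),\dots,Tr(v_n))-D(G)$. Its eigenvalues (all real) are the distance Laplacian eigenvalues of $G$. For an interval $I\subseteq\mathbb{R}$, $m_{D^L(G)}I$ denotes the number of distance Laplacian eigenvalues of $G$, counted with multiplicity, lying in $I$. *)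

(* Defs.v *)
From mathcomp Require Import all_boot all_order all_algebra.
From mathcomp Require Import polyrcf.

Set Implicit Arguments.
Unset Strict Implicit.
Unset Printing Implicit Defensive.

Import Order.TTheory GRing.Theory Num.Theory.

Record sgraph (n : nat) := SGraph {
  adj :> rel 'I_n;
  adj_sym : symmetric adj;
  adj_irr : irreflexive adj
}.

Definition connected n (G : sgraph n) : Prop :=
  (0 < n)%N /\ forall u v : 'I_n, connect G u v.

Definition has_path n (G : sgraph n) (u v : 'I_n) (k : nat) : bool :=
  [exists p : k.-tuple 'I_n,
    [&& path G u p, uniq (u :: p) & last u p == v]].

(* A path has at most n - 1 edges, so the least k with has_path G u v k, when
   there is one, is found in iota 0 n; [find] returns its index, which is k.
   If v is not reachable from u, the (junk) value is n. *)
Definition dist n (G : sgraph n) (u v : 'I_n) : nat :=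
  find (has_path G u v) (iota 0 n).

Definition transmission n (G : sgraph n) (v : 'I_n) : nat :=
  (\sum_(u < n) dist G u v)%N.

Definition colorable n (G : sgraph n) (k : nat) : bool :=
  [exists f : {ffun 'I_n -> 'I_k}, [forall x, forall y, G x y ==> (f x != f y)]].

Lemma colorable_order n (G : sgraph n) : exists k, colorable G k.
Proof.
exists n; apply/existsP; exists [ffun x => x].
apply/forallP=> x; apply/forallP=> y; apply/implyP=> Gxy; rewrite !ffunE.
by apply: contraTneq Gxy => ->; rewrite adj_irr.
Qed.

Definition chromatic_number n (G : sgraph n) : nat :=
  ex_minn (colorable_order G).

Definition complete_multipartite n (G : sgraph n) : Prop :=
  exists P : {set {set 'I_n}},
    partition P [set: 'I_n] /\
    forall x y : 'I_n, G x y = (pblock P x != pblock P y).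

Local Open Scope ring_scope.

Definition distance_mx (R : pzRingType) n (G : sgraph n) : 'M[R]_n :=
  \matrix_(i, j) (dist G i j)%:R.

Definition dist_laplacian (R : pzRingType) n (G : sgraph n) : 'M[R]_n :=
  diag_mx (\row_i (transmission G i)%:R) - distance_mx R G.

(* rootsR lists the distinct real roots; mup is the multiplicity of each. *)
Definition eig_count (R : rcfType) n (A : 'M[R]_n) (I : interval R) : nat :=
  (\sum_(x <- rootsR (char_poly A) | x \in I) mup x (char_poly A))%N.

(* Main.v *)
(* For a proper colouring with [k] colours, the vectors summing to zero on every
   colour class form a space of codimension at most [k] on which the quadratic
   form [\sum_(i < j) d_ij |x_i - x_j|^2] of the distance Laplacian is at least
   [(n + 2) |x|^2]. Hence at most [k] eigenvalues are below [n + 2], and one of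
   these is [0], which is not in [[n, n + 2)]. For a complete multipartite graph,
   [D^L - n] has rank at most 1 on the span of the indicator vectors of the
   parts, so [n] has multiplicity at least (number of parts) - 1. *)

Require Import Defs.
From mathcomp Require Import all_boot all_order all_algebra.
From mathcomp Require Import reals.
From mathcomp Require Import polyrcf complex ring.

Set Implicit Arguments.
Unset Strict Implicit.
Unset Printing Implicit Defensive.

Import Order.TTheory GRing.Theory Num.Theory.
Local Open Scope ring_scope.
Local Open Scope sesquilinear_scope.

(** * Eigenvalue counts and ranks for diagonalized matrices *)

Lemma char_poly_conj (F : fieldType) n (P A : 'M[F]_n) :
  P \in unitmx -> char_poly (invmx P *m A *m P) = char_poly A.
Proof.
move=> Pu; rewrite /char_poly /char_poly_mx !map_mxM /=.
set Q := map_mx polyC P; set Q' := map_mx polyC (invmx P).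
have QK : Q' *m Q = 1%:M by rewrite -map_mxM mulVmx // map_mx1.
rewrite -[X in X - _](_ : Q' *m 'X%:M *m Q = _); last first.
  by rewrite scalar_mxC -mulmxA QK mulmx1.
by rewrite -mulmxBl -mulmxBr !det_mulmx mulrAC -det_mulmx QK det1 mul1r.
Qed.

Lemma char_poly_diag (F : fieldType) n (d : 'rV[F]_n) :
  char_poly (diag_mx d) = \prod_i ('X - (d 0 i)%:P).
Proof.
rewrite char_poly_trig ?diag_mx_is_trig //.
by apply: eq_bigr => i _; rewrite mxE eqxx mulr1n.
Qed.

(** The multiplicity of [x] is the number of [i] with [d i = x]. After exchanging the two sums, each
    [i] with [d i] in [I] is counted once, since the list of distinct roots contains [d i] exactly
    once. *)
Lemma eig_count_split (R : rcfType) n (A : 'M[R]_n) (d : 'I_n -> R) I :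
  char_poly A = \prod_i ('X - (d i)%:P) ->
  eig_count A I = #|[pred i | d i \in I]|.
Proof.
move=> Ad; rewrite /eig_count.
have p0 : char_poly A != 0 by rewrite monic_neq0 // char_poly_monic.
have mupE x : mup x (char_poly A) = (\sum_i (d i == x))%N.
  rewrite Ad -(big_map d xpredT (fun y => 'X - y%:P)) mu_prod_XsubC.
  rewrite -sum1_count big_map big_mkcond /=.
  by apply: eq_bigr => i _; case: eqP.
under eq_bigr => x _ do rewrite mupE.
rewrite exchange_big -sum1_card [RHS]big_mkcond /=; apply: eq_bigr => i _.
have dR : d i \in rootsR (char_poly A).
  rewrite -(roots_on_rootsR p0) in_itv /= Ad.
  by rewrite (bigD1 i) //= rootM root_XsubC eqxx.
have [dI|dI] := boolP (d i \in I).
  rewrite inE /= dI big_mkcond (bigD1_seq (d i)) ?uniq_roots //= dI eqxx.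
  by rewrite big1 ?addn0 // => x; rewrite eq_sym => /negPf->; case: ifP.
rewrite inE /= (negPf dI) big1 // => x xI.
by case: eqP => // dx; rewrite -dx (negPf dI) in xI.
Qed.

(** The principal submatrix on the nonzero entries is invertible. *)
Lemma rank_diag_mx_ge (F : fieldType) n (d : 'rV[F]_n) :
  (#|[pred i | d 0%R i != 0%R]| <= \rank (diag_mx d))%N.
Proof.
set S := [pred i | _]; pose f := @enum_val _ S.
pose D := diag_mx (\row_s d 0 (f s)).
have Du : D \in unitmx.
  rewrite unitmxE det_diag unitfE; apply/prodf_neq0 => s _; rewrite mxE.
  exact: (enum_valP s).
have DE : D = rowsub f 1%:M *m diag_mx d *m colsub f 1%:M.
  rewrite mul_rowsub_mx mul1mx mulmx_colsub mulmx1.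
  by apply/matrixP => s t; rewrite !mxE (inj_eq enum_val_inj).
rewrite -(eqP (etrans (row_free_unit _) Du)) DE.
exact: leq_trans (mxrankM_maxl _ _) (mxrankM_maxr _ _).
Qed.

Lemma rank_eigenspace_le (F : fieldType) n (P : 'M[F]_n) (d : 'rV[F]_n) a :
  P \in unitmx ->
  (\rank (eigenspace (invmx P *m diag_mx d *m P) a)
     <= #|[pred i | d 0%R i == a]|)%N.
Proof.
move=> Pu; rewrite mxrank_ker.
have -> : a%:M = invmx P *m a%:M *m P.
  by rewrite scalar_mxC -mulmxA mulVmx // mulmx1.
rewrite -mulmxBl -mulmxBr mxrankMfree ?row_free_unit //.
rewrite eqmxMfull ?row_full_unit ?unitmx_inv //.
rewrite -diag_const_mx -raddfB /= leq_subLR.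
rewrite -[X in (X <= _)%N](card_ord n) -(cardC [pred i | d 0 i == a]) addnC leq_add2r.
apply: leq_trans (rank_diag_mx_ge _); apply: subset_leq_card.
by apply/subsetP => i; rewrite !inE !mxE subr_eq0.
Qed.

(** A Courant-Fischer argument: the rows of [P] with [d 0 i < c], if more than [k], span a space
    that meets the kernel of [B] nontrivially, and on it the form is strictly below [c] times the
    squared norm. *)
Lemma card_spectrum_lt (C : numClosedFieldType) n k (P : 'M[C]_n)
    (d : 'rV[C]_n) (B : 'M[C]_(n, k)) (c : C) :
  P \is unitarymx ->
  (forall v : 'rV_n, v *m B = 0 ->
     c * (v *m v^t*) 0 0 <= (v *m (invmx P *m diag_mx d *m P) *m v^t*) 0 0) ->
  (#|[pred i | (d 0 i < c)%R]| <= k)%N.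
Proof.
move=> Pu Bc; set S := [pred i | _]; rewrite leqNgt; apply/negP => kS.
have PP : P *m P^t* = 1%:M by exact/unitarymxP.
pose f := @enum_val _ S.
have : kermx (rowsub f P *m B) != 0.
  rewrite -mxrank_eq0 mxrank_ker -lt0n subn_gt0.
  by apply: leq_ltn_trans kS; rewrite rank_leq_col.
case/rowV0Pn => y /sub_kermxP; rewrite mulmxA => yB y0.
(* [z] extends [y] by zero outside [S]; these are the coordinates of the chosen vector in the
   orthonormal basis of rows of [P]. *)
pose z : 'rV[C]_n := y *m rowsub f 1%:M.
have yE : y *m rowsub f P = z *m P by rewrite /z -mulmxA mul_rowsub_mx mul1mx.
have zS i : i \notin S -> z 0 i = 0.
  move=> iS; rewrite mxE big1 // => s _; rewrite !mxE.
  case: eqP => [E|_]; last by rewrite mulr0.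
  by rewrite -E enum_valP in iS.
have z0 : z != 0.
  case/rV0Pn: y0 => s ys; apply/rV0Pn; exists (f s).
  rewrite mxE (bigD1 s) //= big1 => [|t ts]; rewrite !mxE ?eqxx ?addr0 ?mulr1 //.
  by rewrite (inj_eq enum_val_inj) (negPf ts) mulr0.
have := Bc _ yB; rewrite yE; apply/negP.
have e1 : z *m P *m (z *m P)^t* = z *m z^t*.
  by rewrite trmx_mul map_mxM mulmxA -[z *m _ *m _]mulmxA PP mulmx1.
have e2 : z *m P *m (invmx P *m diag_mx d *m P) *m (z *m P)^t* =
    z *m diag_mx d *m z^t*.
  rewrite trmx_mul map_mxM !mulmxA mulmxK ?unitarymx_unit //.
  by rewrite -[_ *m P *m _]mulmxA PP mulmx1.
suff : (z *m diag_mx d *m z^t*) 0 0 < c * (z *m z^t*) 0 0.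
  by rewrite e1 e2 => /lt_geF->.
have ci i : 0 <= (c - d 0 i) * `|z 0 i| ^+ 2.
  have [iS|/zS->] := boolP (i \in S); last by rewrite normr0 expr0n mulr0.
  by rewrite mulr_ge0 ?exprn_ge0 // subr_ge0 ltW.
rewrite -subr_gt0; have -> : c * (z *m z^t*) 0 0 - (z *m diag_mx d *m z^t*) 0 0
    = \sum_i (c - d 0 i) * `|z 0 i| ^+ 2.
  rewrite [X in c * X]mxE [X in _ - X]mxE mulr_sumr -sumrB.
  apply: eq_bigr => i _; rewrite mul_mx_diag !mxE normCK.
  by rewrite mulrBl !mulrA [d 0 i * _]mulrC.
case/rV0Pn: z0 => i zi; have iS : i \in S by apply: contraNT zi => /zS->.
rewrite (bigD1 i) //= ltr_pwDl ?sumr_ge0 //.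
by rewrite mulr_gt0 ?exprn_gt0 ?normr_gt0 // subr_gt0.
Qed.

(* The spectral theorem is only available over an algebraically closed field,
   so the diagonalization is carried out over the complexification of [R]. *)
Lemma symmetric_spectrum (R : rcfType) n (A : 'M[R]_n) : A^T = A ->
  exists d : 'I_n -> R,
    [/\ forall I : interval R, eig_count A I = #|[pred i | d i \in I]|,
        forall a, (\rank (eigenspace A a) <= #|[pred i | d i == a]|)%N
      & forall k (B : 'M[R[i]]_(n, k)) c,
          (forall v : 'rV_n, v *m B = 0 ->
             c%:C%C * (v *m v^t*) 0 0
               <= (v *m map_mx (real_complex R) A *m v^t*) 0 0) ->
          (#|[pred i | (d i < c)%R]| <= k)%N].
Proof.
move=> At; set A' := map_mx _ A.
have A'h : A' \is hermsymmx.
  apply/is_hermitianmxP; rewrite expr0 scale1r.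
  apply/matrixP => i j; rewrite !mxE -[in LHS]At mxE.
  by apply/esym/CrealP; apply/complex_realP; exists (A j i).
have A'E := orthomx_spectralP (hermitian_normalmx A'h).
have := hermitian_spectral_diag_real A'h.
set P := spectralmx A' in A'E *; set e := spectral_diag A' in A'E * => er.
have Pu : P \is unitarymx by exact: spectral_unitarymx.
have PU := unitarymx_unit Pu.
pose d i := complex.Re (e 0 i).
have de i : e 0 i = (d i)%:C%C.
  by have /mxOverP/(_ 0 i)/RRe_real := er.
exists d; split.
(* The factorization over [R] is checked after embedding into the complex polynomials, which is
   injective. *)
- move=> I; apply: eig_count_split; apply: (map_poly_inj (real_complex R)).
  rewrite map_char_poly -/A' A'E char_poly_conj // char_poly_diag rmorph_prod.
  by apply: eq_bigr => i _; rewrite rmorphB /= map_polyX map_polyC /= de.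
- move=> a.
  rewrite (_ : \rank _ = \rank (eigenspace A' a%:C%C)); last first.
    by rewrite -map_eigenspace mxrank_map.
  rewrite A'E; apply: leq_trans (rank_eigenspace_le _ _ PU) _.
  apply: subset_leq_card; apply/subsetP => i; rewrite !inE de.
  by rewrite (inj_eq (@complexI _)).
- move=> k B c Bc; rewrite A'E in Bc.
  apply: leq_trans (card_spectrum_lt Pu Bc).
  by apply: subset_leq_card; apply/subsetP => i; rewrite !inE de ltcR.
Qed.

(** * Distances in a graph *)

Lemma has_path_sym n (G : sgraph n) u v k : has_path G u v k -> has_path G v u k.
Proof.
case/existsP => p /and3P[Gp Up /eqP vE]; rewrite -{v}vE.
have sz : size (rev (belast u p)) == k by rewrite size_rev size_belast size_tuple.
apply/existsP; exists (Tuple sz); apply/and3P; split => /=.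
- rewrite rev_path; by apply: sub_path Gp => x y; rewrite adj_sym.
- rewrite -[_ && _]/(uniq (last u p :: rev (belast u p))).
  by rewrite -rev_rcons -lastI rev_uniq.
- by case: {Gp Up sz} (tval p) => //= a s; rewrite rev_cons last_rcons.
Qed.

Lemma dist_sym n (G : sgraph n) u v : dist G u v = dist G v u.
Proof.
by apply: eq_find => k; apply/idP/idP; apply: has_path_sym.
Qed.

Lemma has_path_dist n (G : sgraph n) u v :
  (dist G u v < n)%N -> has_path G u v (dist G u v).
Proof.
move=> lt; have h : has (has_path G u v) (iota 0 n) by rewrite has_find size_iota.
by have := nth_find 0%N h; rewrite nth_iota.
Qed.

Lemma dist_le n (G : sgraph n) u v k :
  (k < n)%N -> has_path G u v k -> (dist G u v <= k)%N.
Proof.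
move=> kn p; rewrite leqNgt; apply/negP => /(before_find 0%N).
by rewrite nth_iota // p.
Qed.

Lemma dist_refl n (G : sgraph n) u : dist G u u = 0%N.
Proof.
apply/eqP; rewrite -leqn0; apply: dist_le; first exact: leq_trans (ltn_ord u).
by apply/existsP; exists [tuple]; rewrite /= eqxx.
Qed.

Lemma dist_gt0 n (G : sgraph n) u v : u != v -> (0 < dist G u v)%N.
Proof.
move=> uv; rewrite lt0n; apply: contraNneq uv => d0.
have := @has_path_dist _ G u v; rewrite d0 => /(_ (leq_trans _ (ltn_ord u))).
by case/(_ isT)/existsP => p; rewrite (tuple0 p) => /and3P[].
Qed.

Lemma dist_gt1 n (G : sgraph n) u v : u != v -> ~~ G u v -> (1 < dist G u v)%N.
Proof.
move=> uv; apply: contraR; rewrite -leqNgt => d1.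
have {}d1 : dist G u v = 1%N by apply/eqP; rewrite eqn_leq d1 dist_gt0.
(* This separates the distance 1 from the default value [n], so that a path of length 1 really
   exists. *)
have n1 : (1 < n)%N.
  by rewrite -[n]card_ord; apply/card_gt1P; exists u, v.
have := @has_path_dist _ G u v; rewrite d1 => /(_ n1)/existsP[p].
by case/tupleP: p => x p; rewrite (tuple0 p) /= andbT => /and3P[Gx _ /eqP <-].
Qed.

Lemma dist_adj n (G : sgraph n) u v : G u v -> dist G u v = 1%N.
Proof.
move=> Guv; have uv : u != v by apply: contraTneq Guv => ->; rewrite adj_irr.
apply/eqP; rewrite eqn_leq dist_gt0 // andbT; apply: dist_le.
  by rewrite -[n]card_ord; apply/card_gt1P; exists u, v.
by apply/existsP; exists [tuple v]; rewrite /= Guv inE uv eqxx.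
Qed.

Lemma dist_common_neighbour n (G : sgraph n) u v w :
  u != v -> ~~ G u v -> G u w -> G w v -> dist G u v = 2.
Proof.
move=> uv nuv uw wv; apply/eqP; rewrite eqn_leq dist_gt1 // andbT.
have uw' : u != w by apply: contraTneq uw => ->; rewrite adj_irr.
have wv' : w != v by apply: contraTneq wv => ->; rewrite adj_irr.
apply: dist_le; last first.
  apply/existsP; exists [tuple w; v].
  by rewrite /= uw wv !inE negb_or uw' uv wv' eqxx.
(* [dist] searches only lengths below [n], so a path of length 2 is found once three distinct
   vertices are exhibited. *)
rewrite -[n]card_ord; apply/card_gt2P; exists u, v, w.
by split=> //; split=> //; rewrite eq_sym.
Qed.

(** * The distance Laplacian and its quadratic form *)

Lemma dist_laplacianE (R : pzRingType) n (G : sgraph n) (i j : 'I_n) :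
  dist_laplacian R G i j = (transmission G i)%:R *+ (i == j) - (dist G i j)%:R.
Proof. by rewrite !mxE. Qed.

Lemma transmissionE n (G : sgraph n) i :
  transmission G i = (\sum_j dist G i j)%N.
Proof. by apply: eq_bigr => j _; rewrite dist_sym. Qed.

Lemma dist_laplacian_tr (R : pzRingType) n (G : sgraph n) :
  (dist_laplacian R G)^T = dist_laplacian R G.
Proof.
apply/matrixP => i j; rewrite mxE !dist_laplacianE dist_sym eq_sym.
by case: eqP => [->|_]; rewrite ?mulr0n.
Qed.

Lemma map_dist_laplacian (R S : pzRingType) (f : {rmorphism R -> S}) n (G : sgraph n) :
  map_mx f (dist_laplacian R G) = dist_laplacian S G.
Proof.
apply/matrixP => i j; rewrite mxE !dist_laplacianE rmorphB rmorphMn.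
by rewrite !rmorph_nat.
Qed.

(** The Laplacian identity for arbitrary symmetric weights, to be applied both to the distances and
    to their lower bounds. Ordered pairs are summed, whence the factor 2. *)
Lemma weighted_square_sum (C : numClosedFieldType) n (w : 'I_n -> 'I_n -> C)
    (x : 'I_n -> C) : (forall i j, w i j = w j i) ->
  \sum_i \sum_j w i j * `|x i - x j| ^+ 2 =
  (\sum_i (\sum_j w i j) * `|x i| ^+ 2
     - \sum_i \sum_j w i j * (x i * (x j)^*)) *+ 2.
Proof.
move=> ws.
(* Half of the terms are written with [w j i], so that exchanging the summations turns them into the
   other half. *)
have e i j : w i j * `|x i - x j| ^+ 2 = (w i j * `|x i| ^+ 2
    + w j i * `|x j| ^+ 2) - (w i j * (x i * (x j)^*) + w j i * (x j * (x i)^*)).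
  by rewrite [w j i]ws !normCK rmorphB /=; ring.
under eq_bigr => i _ do rewrite (eq_bigr _ (fun j _ => e i j)) sumrB !big_split /=.
rewrite sumrB !big_split /=.
rewrite [X in _ + X - _]exchange_big [X in _ - (_ + X)]exchange_big /=.
rewrite -!mulr2n -mulrnBl; congr ((_ - _) *+ 2).
by apply: eq_bigr => i _; rewrite mulr_suml.
Qed.

Lemma dist_laplacian_form (C : numClosedFieldType) n (G : sgraph n) (v : 'rV[C]_n) :
  (v *m dist_laplacian C G *m v^t*) 0 0 *+ 2 =
  \sum_i \sum_j (dist G i j)%:R * `|v 0 i - v 0 j| ^+ 2.
Proof.
rewrite weighted_square_sum => [|i j]; last by rewrite dist_sym.
congr (_ *+ 2); rewrite mulmxBr mulmxBl mxE [X in _ + X]mxE; congr (_ - _).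
  rewrite mul_mx_diag mxE; apply: eq_bigr => i _.
  by rewrite !mxE transmissionE natr_sum normCK mulrAC mulrC.
rewrite mxE exchange_big; apply: eq_bigr => j _.
rewrite [X in X * _]mxE mulr_suml; apply: eq_bigr => i _.
by rewrite !mxE mulrA mulrAC mulrC mulrA.
Qed.

(* A vector summing to zero on every colour class vanishes on singleton classes,
   and distinct vertices of one class are at distance at least 2, so replacing
   each distance by [1 + (same class)] bounds the form from below by
   [\sum_i (n + #|class of i|) * `|v 0 i| ^+ 2]. *)
Lemma dist_laplacian_form_ge (C : numClosedFieldType) n k (G : sgraph n)
    (f : 'I_n -> 'I_k) (v : 'rV[C]_n) :
  (forall i j, G i j -> f i != f j) ->
  v *m \matrix_(i, c) (f i == c)%:R = 0 ->
  (n + 2)%:R * (v *m v^t*) 0 0 <= (v *m dist_laplacian C G *m v^t*) 0 0.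
Proof.
move=> fG v0.
have class0 c : \sum_(j | f j == c) v 0 j = 0.
  have /matrixP/(_ 0 c) := v0; rewrite !mxE => e; rewrite -[RHS]e big_mkcond.
  by apply: eq_bigr => j _; rewrite mxE mulr_natr mulrb.
have sum0 : \sum_j v 0 j = 0.
  by rewrite (partition_big f xpredT) //= big1.
pose w i j : C := 1 + (f i == f j)%:R.
rewrite -(ler_pMn2r (_ : 0 < 2)%N) // dist_laplacian_form.
apply: (@le_trans _ _ (\sum_i \sum_j w i j * `|v 0 i - v 0 j| ^+ 2)); last first.
  apply: ler_sum => i _; apply: ler_sum => j _.
  have [->|ij] := eqVneq i j; first by rewrite subrr normr0 expr0n !mulr0.
  rewrite ler_wpM2r ?exprn_ge0 // /w nat1r ler_nat.
  case: eqP => [fij|_]; last exact: dist_gt0.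
  by apply: dist_gt1 => //; apply/negP => /fG; rewrite fij eqxx.
rewrite weighted_square_sum => [|i j]; last by rewrite /w eq_sym.
(* For fixed [i], the mixed terms add up to a multiple of the conjugate of the total sum plus the
   sum over the class of [i], and both sums vanish. *)
rewrite [X in _ - X]big1 ?subr0 => [|i _]; last first.
  under eq_bigr => j _ do rewrite mulrCA.
  rewrite -mulr_sumr; apply/eqP; rewrite mulf_eq0; apply/orP; right.
  under eq_bigr => j _ do rewrite mulrDl mul1r.
  rewrite big_split /= -rmorph_sum sum0 rmorph0 add0r.
  under eq_bigr => j _ do rewrite mulr_natl mulrb.
  rewrite -big_mkcond /= -rmorph_sum.
  by under eq_bigl => j do rewrite eq_sym; rewrite class0 rmorph0.
rewrite ler_pMn2r // mxE mulr_sumr; apply: ler_sum => i _.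
rewrite !mxE -normCK.
have wE : \sum_j w i j = (n + #|[pred j | f j == f i]|)%:R.
  rewrite big_split /= sumr_const card_ord natrD; congr (_ + _).
  rewrite -sum1_card natr_sum [RHS]big_mkcond /=; apply: eq_bigr => j _.
  by rewrite inE eq_sym; case: eqP.
have [vi|vi] := eqVneq (v 0 i) 0; first by rewrite vi normr0 expr0n !mulr0.
rewrite wE ler_wpM2r ?exprn_ge0 // ler_nat leq_add2l.
rewrite ltnNge; apply: contraNN vi => c1.
have := class0 (f i); rewrite (bigD1 i) //= big1 ?addr0 => [/eqP//|j /andP[ji nij]].
suff : (1 < #|[pred j | f j == f i]|)%N by rewrite ltnNge c1.
by apply/card_gt1P; exists i, j; rewrite !inE eqxx ji eq_sym nij.
Qed.

(** The all-ones vector is in the kernel, because every column sums to zero. *)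
Lemma dist_laplacian_ker (R : fieldType) n (G : sgraph n) : (0 < n)%N ->
  (0 < \rank (eigenspace (dist_laplacian R G) 0))%N.
Proof.
move=> n0; suff e : (const_mx 1 : 'rV_n) *m dist_laplacian R G = 0.
  have le1 : ((const_mx 1 : 'rV_n) <= eigenspace (dist_laplacian R G) 0)%MS.
    by apply/eigenspaceP; rewrite scale0r.
  apply: leq_trans (mxrankS le1); rewrite lt0n mxrank_eq0.
  by apply/rV0Pn; exists (Ordinal n0); rewrite mxE oner_eq0.
apply/rowP => j; rewrite !mxE.
under eq_bigr => i _ do rewrite mxE mul1r dist_laplacianE.
rewrite sumrB (bigD1 j) //= eqxx mulr1n big1 ?addr0 => [|i /negPf->]; last first.
  by rewrite mulr0n.
by rewrite /transmission natr_sum subrr.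
Qed.

(** * Complete multipartite graphs *)

(** Two vertices of one part have a common neighbour: a path between them first steps to some [w] in
    another part, and [w] is adjacent to both. The doubled term corrects the diagonal, where the
    distance is 0 instead of 2. *)
Lemma dist_multipartite n (G : sgraph n) (P : {set {set 'I_n}}) i j :
  connected G -> (forall x y, G x y = (pblock P x != pblock P y)) ->
  (dist G i j + (i == j).*2 = 1 + (pblock P i == pblock P j))%N.
Proof.
move=> [_ Gc] GP; have [<-|ij] := eqVneq i j; first by rewrite dist_refl !eqxx.
rewrite addn0; have [Pij|Pij] := eqVneq (pblock P i) (pblock P j); last first.
  by rewrite dist_adj ?GP.
have /connectP[[|w p] /= Gp] := Gc i j.
  by move=> ji; rewrite ji eqxx in ij.
move=> _; move/andP: Gp => [Giw _].
apply: (@dist_common_neighbour _ _ _ _ w) => //.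
  by rewrite GP Pij eqxx.
by rewrite GP -Pij -GP adj_sym.
Qed.

Lemma transmission_multipartite n (G : sgraph n) (P : {set {set 'I_n}}) j :
  connected G -> (forall x y, G x y = (pblock P x != pblock P y)) ->
  (transmission G j + 2 = n + \sum_i (pblock P i == pblock P j))%N.
Proof.
move=> Gc GP; transitivity (\sum_i (1 + (pblock P i == pblock P j)))%N.
  under [RHS]eq_bigr => i _ do rewrite -(dist_multipartite i j Gc GP).
  rewrite big_split /=; congr (_ + _)%N.
  by rewrite (bigD1 j) //= eqxx big1 // => i /negPf->.
by rewrite big_split /= sum1_card card_ord.
Qed.

(** Let [K] hold the part sizes, [S] be the same-part matrix and [J] the all-ones matrix. Then
    [D^L - n = diag K - S - J]. On indicators of parts [diag K] and [S] agree, so only [-J], of rank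
    at most 1, remains. *)
Lemma rank_eigenspace_multipartite (R : fieldType) n (G : sgraph n)
    (P : {set {set 'I_n}}) :
  connected G -> partition P [set: 'I_n] ->
  (forall x y, G x y = (pblock P x != pblock P y)) ->
  (#|P| - 1 <= \rank (eigenspace (dist_laplacian R G) n%:R))%N.
Proof.
move=> Gc Ppart GP.
have [/eqP Pc Ptriv P0] := and3P Ppart.
pose block (c : 'I_#|P|) : {set 'I_n} := enum_val c.
have blockE c i : (i \in block c) = (pblock P i == block c).
  apply/idP/eqP => [|<-]; last by rewrite mem_pblock Pc inE.
  exact: def_pblock (enum_valP c).
pose E : 'M[R]_(#|P|, n) := \matrix_(c, i) (i \in block c)%:R.
(* Choosing one representative in each part gives a right inverse of [E]. *)
pose D : 'M[R]_(n, #|P|) := \matrix_(i, c) ([pick x in block c] == Some i)%:R.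
have ED : E *m D = 1%:M.
  apply/matrixP => c c'; rewrite !mxE.
  have [x xc' px] : exists2 x, x \in block c' & [pick x in block c'] = Some x.
    case: pickP => [x xc|e]; first by exists x.
    have /set0Pn[x] : block c' != set0.
      by apply: contraNneq P0 => <-; exact: enum_valP.
    by rewrite [_ \in _]e.
  rewrite (bigD1 x) //= big1 => [|y yx]; last first.
    by rewrite !mxE px [_ == _](inj_eq Some_inj) eq_sym (negPf yx) mulr0.
  rewrite !mxE px eqxx mulr1 addr0 blockE.
  by move: xc'; rewrite blockE => /eqP->; rewrite (inj_eq enum_val_inj) eq_sym.
have rE : \rank E = #|P|.
  apply/eqP; rewrite eqn_leq rank_leq_row -{1}(mxrank1 R #|P|) -ED.
  exact: mxrankM_maxl.
set X := dist_laplacian R G - n%:R%:M.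
have EX : E *m X = - (E *m const_mx 1) *m (const_mx 1 : 'rV_n).
  pose K j : R := \sum_i (pblock P i == pblock P j)%:R.
  have XE i j : X i j = K j *+ (i == j) - (pblock P i == pblock P j)%:R - 1.
    rewrite !mxE /K.
    have [->|ij] := eqVneq i j.
      have := congr1 (fun m => m%:R : R) (transmission_multipartite j Gc GP).
      rewrite !natrD natr_sum dist_refl eqxx /= !mulr1n.
      by move/(canRL (addrK _)) => ->; ring.
    have := congr1 (fun m => m%:R : R) (dist_multipartite i j Gc GP).
    by rewrite (negPf ij) !natrD /= !mulr0n addr0 => ->; ring.
  apply/matrixP => c j; rewrite mulNmx 2!mxE [X in - X]mxE big_ord1.
  rewrite [X in - (X * _)]mxE [X in _ * X]mxE mulr1.
  under eq_bigr => i _ do rewrite XE mulrBr mulrBr.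
  rewrite sumrB; under [X in _ - X]eq_bigr => i _ do rewrite mulr1.
  rewrite [in RHS](eq_bigr (E c)) => [|i _]; last by rewrite [X in _ * X]mxE mulr1.
  rewrite -[RHS]add0r; congr (_ - _); rewrite sumrB (bigD1 j) //= eqxx mulr1n.
  rewrite big1 ?addr0 => [|i /negPf->]; last by rewrite mulr0n mulr0.
  (* The contributions of [diag K] and [S] agree term by term: [i] and [j] in one part lie both
     inside or both outside [block c]. *)
  apply/eqP; rewrite subr_eq0; apply/eqP; rewrite mulr_sumr.
  apply: eq_bigr => i _; rewrite !mxE !blockE.
  by case: (pblock P i =P pblock P j) => [->|_]; rewrite ?mulr0.
(* Rank-nullity on the row space of [E]; the kernel of [X] is the eigenspace. *)
rewrite -{1}rE -(mxrank_mul_ker E X) leq_subLR leq_add //.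
  by rewrite EX; apply: leq_trans (mxrankM_maxr _ _) (rank_leq_row _).
by rewrite mxrankS // capmxSr.
Qed.

Theorem theorem2p6 (R : realType) (n : nat) (G : sgraph n)
    (Gconn : connected G) :
  (eig_count (dist_laplacian R G) `[n%:R, (n + 2)%:R[%R
     <= chromatic_number G - 1)%N
  /\ (complete_multipartite G ->
      eig_count (dist_laplacian R G) `[n%:R, (n + 2)%:R[%R
        = (chromatic_number G - 1)%N).
Proof.
have [d [-> rank_le card_le]] := symmetric_spectrum (dist_laplacian_tr R G).
have n0 := Gconn.1.
pose I : interval R := `[n%:R, (n + 2)%:R[; rewrite -/I.
have inI i : (i \in [pred i | d i \in I]) = (n%:R <= d i < (n + 2)%:R).
  by rewrite -[LHS]/(d i \in I) in_itv.
rewrite /chromatic_number; case: ex_minnP => k kcol kmin.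
have ub : (#|[pred i | d i \in I]| <= k - 1)%N.
  case/existsP: kcol => f /forallP fG.
  have fP i j : G i j -> f i != f j by have /forallP/(_ j)/implyP := fG i.
  (* The kernel of the incidence matrix of vertices and colours consists of the vectors summing to
     zero on every colour class. *)
  have ltk : (#|[pred i | (d i < (n + 2)%:R)%R]| <= k)%N.
    apply: card_le (\matrix_(i, c) (f i == c)%:R) _ _ => v.
    by rewrite map_dist_laplacian rmorph_nat; apply: dist_laplacian_form_ge.
  have k0 : (0 < k)%N by exact: leq_ltn_trans (ltn_ord (f (Ordinal n0))).
  rewrite leq_subRL //; apply: leq_trans ltk.
  (* The eigenvalue 0 is below [n + 2] but, as [n > 0], outside [I]; it takes one of the [k]
     places. *)
  have c0 : (0 < #|[pred i | d i == 0%R]|)%N.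
    exact: leq_trans (dist_laplacian_ker R G n0) (rank_le 0).
  apply: leq_trans (leq_add c0 (leqnn _)) _; rewrite -cardUI.
  rewrite [X in (_ + X)%N]eq_card0 ?addn0 => [|i]; last first.
    rewrite inE [X in _ && X]inI inE; case: eqP => // ->.
    by rewrite lern0 eqn0Ngt n0.
  apply: subset_leq_card; apply/subsetP => i; rewrite inE [X in _ || X]inI !inE.
  by case/orP => [/eqP->|/andP[]//]; rewrite ltr0n addn2.
split=> // -[P [Ppart GP]]; apply/eqP; rewrite eqn_leq ub /=.
have [/eqP Pc Ptriv P0] := and3P Ppart.
have Px (x : 'I_n) : pblock P x \in P by rewrite pblock_mem // Pc inE.
(* Colouring each vertex by its part is proper. *)
have kP : (k <= #|P|)%N.
  apply: kmin; apply/existsP; exists [ffun x => enum_rank_in (Px x) (pblock P x)].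
  apply/forallP => x; apply/forallP => y; apply/implyP; rewrite GP !ffunE.
  apply: contraNneq => e; apply/eqP.
  by rewrite -(enum_rankK_in (Px x) (Px x)) e enum_rankK_in.
apply: leq_trans (leq_sub2r 1 kP) _.
(* The eigenvalue [n], the closed end of [I], alone accounts for [#|P| - 1] of the count. *)
apply: leq_trans (rank_eigenspace_multipartite R Gconn Ppart GP) _.
apply: leq_trans (rank_le _) _; apply: subset_leq_card.
apply/subsetP => i; rewrite inI inE => /eqP->.
by rewrite lexx ltr_nat addn2 leqnSn.
Qed.
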